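(* Let $\Omega$ be a countably infinite set, and let $\mathcal{O}(\Omega)$ be the monoid of all surjective functions from $\Omega$ to $\Omega$. For $s,t\in\mathcal{O}(\Omega)$ write $s\approx t$ if any of the following conditions holds. (1) $|N(s)|,|N(t)|<\aleph_0$, and $|N(s)|-|C(s)|=|N(t)|-|C(t)|$. (2) $|N(s)|=|N(t)|=\aleph_0$, and $m(s),m(t)<\aleph_0$. (3) $m(s)=m(t)=\aleph_0$, but $s$ and $t$ do not achieve $m(s)=m(t)$. (4) $m(s)=m(t)=\aleph_0$, and $s$ and $t$ achieve $m(s)=m(t)$. Then $\approx$ is a congruence on $\mathcal{O}(\Omega)$, and $\sim_s\,\subseteq\,\approx$.
   Context: For $s:\Omega\to\Omega$: $N(s)=\{\alpha\in\Omega\mid\exists\beta\in\Omega\setminus\{\alpha\}\ (s(\alpha)=s(\beta))\}$; $C(s)=\{\alpha\in\Omega\mid|s^{-1}(\alpha)|>1\}$; $m(s)=\sup\{|s^{-1}(\alpha)|\mid\alpha\in\Omega\}$ (a cardinal). We say $s$ achieves $m(s)$ if $m(s)=|s^{-1}(\alpha)|$ for some $\alpha\in\Omega$; in (3) neither $s$ nor $t$ achieves it, in (4) both do. For a monoid $S$ and $s,t\in S$, $s\sim_s^1 t$ means there exist a positive integer $n$, elements $p_1,\dots,p_n\in S$, and a permutation $f$ of $\{1,\dots,n\}$ with $s=p_1\cdots p_n$ and $t=p_{f(1)}\cdots p_{f(n)}$; $\sim_s$ is the transitive closure of $\sim_s^1$. A congruence is an equivalence relation compatible with left and right multiplication. Here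 the monoid is $S=\mathcal{O}(\Omega)$ under composition. *)

(* Defs.v *)
From HB Require Import structures.
From mathcomp Require Import all_boot all_order all_algebra all_fingroup.
From mathcomp Require Import finmap.
From mathcomp Require Import boolp classical_sets functions cardinality.
From Stdlib Require Export RelationClasses Relation_Operators.

Set Implicit Arguments.
Unset Strict Implicit.
Unset Printing Implicit Defensive.

Local Open Scope classical_set_scope.
Local Open Scope card_scope.

Record surjmap (T : choiceType) := SurjMap {
  surjmap_fun :> T -> T;
  _ : `[< set_surj [set: T] [set: T] surjmap_fun >] }.

HB.instance Definition _ (T : choiceType) :=
  [isSub for @surjmap_fun T].
HB.instance Definition _ (T : choiceType) := [Choice of surjmap T by <:].

Section SurjMonoid.
Context {T : choiceType}.
Implicit Types s t u : surjmap T.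

Lemma surjmapP s : set_surj [set: T] [set: T] s.
Proof. by case: s => f /= /asboolP. Qed.

Lemma id_surj : `[< set_surj [set: T] [set: T] (@idfun T) >].
Proof. by apply/asboolP => x _; exists x. Qed.

Lemma comp_surj s t : `[< set_surj [set: T] [set: T] (s \o t) >].
Proof.
apply/asboolP => x _; have [y _ <-] := surjmapP s (I : [set: T] x).
by have [z _ <-] := surjmapP t (I : [set: T] y); exists z.
Qed.

Definition surjmap_one : surjmap T := SurjMap id_surj.
Definition surjmap_mul s t : surjmap T := SurjMap (comp_surj s t).

Lemma surjmap_mulA : associative surjmap_mul.
Proof. by move=> s t u; apply: val_inj. Qed.

Lemma surjmap_mul1 : left_id surjmap_one surjmap_mul.
Proof. by move=> s; apply: val_inj. Qed.

Lemma surjmap_mulr1 : right_id surjmap_one surjmap_mul.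
Proof. by move=> s; apply: val_inj. Qed.

HB.instance Definition _ :=
  isMonoid.Build (surjmap T) surjmap_mulA surjmap_mul1 surjmap_mulr1.

End SurjMonoid.

Section MonoidRelations.
Variable S : monoidType.
Implicit Types s t u : S.

Definition congruence (R : S -> S -> Prop) : Prop :=
  Equivalence R /\
  forall s t u, R s t -> R (u * s)%g (u * t)%g /\ R (s * u)%g (t * u)%g.

Definition perm_sim1 s t : Prop :=
  exists (n : nat) (p : 'I_n -> S) (f : 'S_n),
    [/\ (0 < n)%N, s = (\prod_(i < n) p i)%g & t = (\prod_(i < n) p (f i))%g].

Definition perm_sim : S -> S -> Prop := clos_trans S perm_sim1.

End MonoidRelations.

(* B represents the least upper bound of the cardinals of the sets F i; since
   cardinals are only compared here, it is unique up to #=. *)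
Definition card_lub I T U (F : I -> set T) (B : set U) : Prop :=
  (forall i, F i #<= B) /\
  (forall (V : Type) (D : set V), (forall i, F i #<= D) -> B #<= D).

Lemma card_lub_unique I T U V (F : I -> set T) (B : set U) (D : set V) :
  card_lub F B -> card_lub F D -> B #= D.
Proof. by move=> [uB lB] [uD lD]; rewrite card_eq_le lB ?lD. Qed.

Lemma card_lub_countable I T (F : I -> set T) :
  (forall i, countable (F i)) -> exists B : set nat, card_lub F B.
Proof.
move=> cF.
have key (V : Type) (D : set V) (n : nat) : ~ (`I_n.+1 #<= D) -> D #<= `I_n.
  move=> nD; have [[m Dm]|/infiniteP Dinf] := pselect (finite_set D).
    rewrite (card_le_eql Dm) card_le_II leqNgt; apply/negP => nm.
    by apply: nD; rewrite (card_le_eqr Dm) card_le_II.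
  by case: nD; apply: card_le_trans (card_leT _) Dinf.
pose P (n : nat) := forall i, F i #<= `I_n.
have [[n Pn]|nP] := pselect (exists n, P n).
  have exP : exists n, `[< P n >] by exists n; apply/asboolP.
  case: (ex_minnP exP) => m /asboolP Pm minm.
  exists `I_m; split=> // V D FD; case: m Pm minm => [|m] Pm minm.
    by rewrite II0; exact: card_ge0.
  have [//|/(key _ D m) Dm] := pselect (`I_m.+1 #<= D).
  have /asboolP/minm : P m by move=> i; exact: card_le_trans (FD i) Dm.
  by rewrite ltnn.
exists [set: nat]; split=> // V D FD; apply/infiniteP => -[m Dm].
by apply: nP; exists m => i; rewrite -(card_le_eqr Dm); exact: FD.
Qed.

Section Cardinals.
Variable T : choiceType.
Implicit Types s t : surjmap T.

Definition fibre s (a : T) : set T := s @^-1` [set a].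

Definition Nset s : set T := [set a | exists b, b <> a /\ s a = s b].

(* Cardinals are totally ordered, so |s^-1(a)| > 1 is the negation of <= 1. *)
Definition Cset s : set T := [set a | ~ (fibre s a #<= `I_1)].

(* The cardinal sup_a |s^-1(a)|, represented by a set of natural numbers; such
   a representative exists when T is countable (see mcardP). *)
Definition mcard s : set nat := xget set0 [set B | card_lub (fibre s) B].

Lemma mcardP s : countable [set: T] -> card_lub (fibre s) (mcard s).
Proof.
move=> cT; apply: (@xgetPex _ set0 [set B | card_lub (fibre s) B]).
by apply: card_lub_countable => a; apply: card_le_trans cT; exact: card_leT.
Qed.

Definition achieves_mcard s : Prop := exists a, mcard s #= fibre s a.

(* card_fset A is the number of elements of A only when A is finite.  In
   surj_approx, Cset s is finite because it is the image of Nset s under s. *)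
Definition card_fset (A : set T) : nat := #|` fset_set A|%fset.

Definition surj_approx s t : Prop :=
  [\/ [/\ finite_set (Nset s), finite_set (Nset t) &
          ((card_fset (Nset s))%:Z - (card_fset (Cset s))%:Z =
           (card_fset (Nset t))%:Z - (card_fset (Cset t))%:Z)%R],
      [/\ Nset s #= [set: nat], Nset t #= [set: nat],
          finite_set (mcard s) & finite_set (mcard t)],
      [/\ mcard s #= [set: nat], mcard t #= [set: nat],
          ~ achieves_mcard s & ~ achieves_mcard t] |
      [/\ mcard s #= [set: nat], mcard t #= [set: nat],
          achieves_mcard s & achieves_mcard t]].

End Cardinals.

(* Main.v *)
From mathcomp Require Import finmap.
Require Import Defs.
From mathcomp Require Import all_boot all_order all_algebra all_fingroup.
From mathcomp Require Import boolp classical_sets functions cardinality.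

Local Open Scope classical_set_scope.
Local Open Scope card_scope.

(**
The classes of the relation are the fibres of a homomorphism from the monoid of
surjections to a commutative monoid; both claims follow from this.

The homomorphism records three things about [s]: its excess |N(s)| - |C(s)|
([None] when N(s) is infinite), whether the sizes of its fibres have a common
finite bound, and whether all its fibres are finite.  The last two behave
well under composition because the fibre of [s * t] over [a] is the preimage
under [t] of the fibre of [s] over [a]: it maps onto that fibre, it contains a
fibre of [t] (and every fibre of [t] arises so), and it has at most n * m
elements when the fibres of [s] and [t] have at most n and m
([fibres_boundedM], [fibres_finiteM]).

The excess is additive ([excessM]).  Choose a right inverse [g] of [s], that is,
one point in each fibre.  The excess is the number of points left over: N(s) is
the disjoint union of the complement of the range of [g] and of the image of
C(s) under the injection [g] ([Nset_section]).  If [h] is a right inverse of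
[t], then [h \o g] is one of [s * t], and the points it leaves over are those
left over by [h] together with the images under [h] of those left over by [g].

Over a countable set the four cases of the relation say exactly that the three
data agree ([surj_approx_fibre_type]): m(s) is infinite when the fibres are
unbounded, it is then aleph_0, and it is achieved when some fibre is infinite;
a finite N(s) bounds the fibres.  Finally, a congruence with commutative
quotient identifies any product with its permutations
([perm_sim_sub_congruence]).
*)

(** * Permuted products and congruences *)

(** The first factor of one product can be found inside the other and, up to the
    congruence, moved to the front; the remaining factors are handled by
    induction. *)
Lemma perm_prod_congruence {S : monoidType} {R : S -> S -> Prop} :
  congruence R -> (forall s t, R (s * t)%g (t * s)%g) ->
  forall (I : eqType) (p : I -> S) (l1 l2 : seq I), perm_eq l1 l2 ->
    R (\prod_(i <- l1) p i)%g (\prod_(i <- l2) p i)%g.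
Proof.
move=> [[Rrefl _ Rtrans] Rmul] Rcomm I p; elim=> [|x l1 IH] l2.
  by rewrite perm_sym => /perm_nilP ->; exact: Rrefl.
move=> p12; have xl2 : x \in l2 by rewrite -(perm_mem p12) mem_head.
case/splitPr: l2 / xl2 p12 => a b.
rewrite perm_sym -cat1s perm_catCA /= perm_cons perm_sym => /IH Rab.
rewrite big_cons big_cat big_cons /=.
apply: Rtrans (proj1 (Rmul _ _ (p x) Rab)) _.
rewrite big_cat /= !mulgA; exact: (proj2 (Rmul _ _ _ (Rcomm _ _))).
Qed.

Lemma perm_sim_sub_congruence {S : monoidType} {R : S -> S -> Prop} :
  congruence R -> (forall s t, R (s * t)%g (t * s)%g) ->
  forall s t, perm_sim s t -> R s t.
Proof.
move=> Rcong Rcomm s t; elim=> {s t} [s t|s t u _ Rst _ Rtu]; last first.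
  by case: Rcong => -[_ _ Rtrans] _; exact: Rtrans Rst Rtu.
move=> [n [p [f [_ -> ->]]]].
have -> : (\prod_(i < n) p (f i) =
           \prod_(j <- [seq f i | i <- index_enum 'I_n]) p j)%g.
  by rewrite big_map.
apply: perm_prod_congruence => //; apply: uniq_perm.
- exact: index_enum_uniq.
- by rewrite (map_inj_uniq perm_inj) index_enum_uniq.
- move=> i; rewrite mem_index_enum; apply/esym/mapP.
  by exists ((f^-1)%g i); rewrite ?mem_index_enum ?permKV.
Qed.

(** * Cardinals of sets, finite or not *)

Section FiniteCardinals.
Set Implicit Arguments.
Unset Strict Implicit.
Variable T : choiceType.
Implicit Types (A B : set T).

Lemma card_le_finP A n :
  A #<= `I_n <-> finite_set A /\ #|` fset_set A|%fset <= n.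
Proof.
split=> [An|[/[dup] Afin /finite_setP[m Am]]].
  by split; [apply/finite_set_leP; exists n|exact: geq_card_fset_set].
by rewrite (card_fset_set Am) (card_le_eql Am) card_le_II.
Qed.

Lemma card_leU_add A B m n :
  A #<= `I_m -> B #<= `I_n -> A `|` B #<= `I_(m + n).
Proof.
move=> /card_le_finP[Af Am] /card_le_finP[Bf Bn].
apply/card_le_finP; split; first by rewrite finite_setU.
rewrite fset_setU // (leq_trans (leq_card_fsetU _ _)) //; exact: leq_add.
Qed.

Lemma card_le1P A : A #<= `I_1 <-> forall x y, A x -> A y -> x = y.
Proof.
split=> [/card_le_finP[Af A1] x y Ax Ay|Auniq].
  have xyA : ([fset x; y] `<=` fset_set A)%fset.
    apply/fsubsetP => z; rewrite !inE in_fset_set // inE.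
    by case/orP => /eqP ->.
  have := leq_trans (fsubset_leq_card xyA) A1.
  by rewrite cardfs2; case: eqP.
have [[x Ax]|A0] := pselect (exists x, A x).
  rewrite -(card_le_eqr (@card_set1 _ x)); apply: subset_card_le => y Ay.
  exact: Auniq.
suff -> : A = set0 by exact: card_ge0.
by rewrite -subset0 => x Ax; apply: A0; exists x.
Qed.

(** Remove the points of [D] one at a time; each takes away at most [m] points
    of the preimage. *)
Lemma card_preimage_le {U : Type} (f : T -> U) (D : set U) m n :
  (forall b, f @^-1` [set b] #<= `I_m) -> D #= `I_n ->
  f @^-1` D #<= `I_(n * m).
Proof.
move=> fm; elim: n D => [|n IH] D.
  rewrite II0 card_eq0 => /eqP ->; rewrite preimage_set0; exact: card_ge0.
move=> /eq_cardSP[b Db /IH Dn].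
rewrite -(setD1K Db) preimage_setU mulSn; exact: card_leU_add.
Qed.

(** [None] stands for every infinite cardinal. *)
Definition fincard A : option nat :=
  if `[< finite_set A >] then Some (card_fset A) else None.

Definition option_add (m n : option nat) : option nat :=
  if m is Some i then if n is Some j then Some (i + j) else None else None.

Lemma fincard_fin A : finite_set A -> fincard A = Some (card_fset A).
Proof. by move=> Af; rewrite /fincard asboolT. Qed.

Lemma fincard_inf A : ~ finite_set A -> fincard A = None.
Proof. by move=> nA; rewrite /fincard asboolF. Qed.

Lemma option_addC : commutative option_add.
Proof. by move=> [m|] [n|] //=; rewrite addnC. Qed.

Lemma card_fsetU_disjoint A B : finite_set A -> finite_set B ->
  A `&` B = set0 -> card_fset (A `|` B) = card_fset A + card_fset B.
Proof.
move=> Af Bf AB0; rewrite /card_fset fset_setU // -cardfsUI.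
by rewrite -fset_setI // AB0 fset_set0 cardfs0 addn0.
Qed.

Lemma fincardU A B : A `&` B = set0 ->
  fincard (A `|` B) = option_add (fincard A) (fincard B).
Proof.
move=> AB0; have [Af|nA] := pselect (finite_set A); last first.
  by rewrite (fincard_inf nA) fincard_inf // finite_setU => -[].
have [Bf|nB] := pselect (finite_set B); last first.
  rewrite option_addC !(fincard_inf nB) fincard_inf //.
  by rewrite finite_setU => -[].
by rewrite !fincard_fin ?finite_setU // card_fsetU_disjoint.
Qed.

Lemma card_fset_image {g : T -> T} A : injective g -> finite_set A ->
  card_fset (g @` A) = card_fset A.
Proof.
by move=> gI Af; rewrite /card_fset fset_set_image // card_imfset.
Qed.

Lemma finite_image_inj {g : T -> T} A : injective g ->
  finite_set (g @` A) -> finite_set A.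
Proof.
move=> gI gAf; apply: card_le_finite gAf.
suff /card_esym/card_eqPle[] : g @` A #= A by [].
by apply: inj_card_eq => x y _ _; exact: gI.
Qed.

Lemma fincard_image {g : T -> T} A : injective g ->
  fincard (g @` A) = fincard A.
Proof.
move=> gI; have [Af|nA] := pselect (finite_set A).
  by rewrite !fincard_fin ?card_fset_image //; exact: finite_image.
by rewrite !fincard_inf // => /(finite_image_inj gI).
Qed.

End FiniteCardinals.

(** * The excess of a surjection *)

Section Surjections.
Set Implicit Arguments.
Unset Strict Implicit.
Variable T : choiceType.
Implicit Types s t : surjmap T.

Lemma surjmap_section s : exists g, cancel g s.
Proof.
have /choice[g gP] : forall a, exists x, s x = a.
  by move=> a; have [x _ <-] := surjmapP s (I : [set: T] a); exists x.
by exists g.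
Qed.

Lemma range_sectionP s g : cancel g s ->
  forall x, range g x <-> g (s x) = x.
Proof.
by move=> gK x; split=> [[a _ <-]|<-]; [rewrite gK|exists (s x)].
Qed.

(** A fibre with two points has one that the right inverse does not choose. *)
Lemma Cset_section s g : cancel g s -> Cset s = s @` (~` range g).
Proof.
move=> gK; apply/seteqP; split=> [a Ca|a [x ngx <-] /card_le1P C1].
  apply: contrapT => na; apply: Ca; apply/card_le1P => x y.
  suff key z : fibre s a z -> z = g a by move=> /key -> /key ->.
  move=> za; apply: contrapT => zg; apply: na; exists z => // /(range_sectionP gK).
  by rewrite za => /esym.
by apply: ngx; apply/(range_sectionP gK); apply: C1; rewrite /fibre /= ?gK.
Qed.

(** A point of N(s) is either left over by [g], or chosen by [g] in a fibre
    that has another point.  Conversely a point [x] that is left over is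
    distinct from the point [g (s x)] of its fibre. *)
Lemma Nset_section s g : cancel g s -> Nset s = ~` range g `|` g @` Cset s.
Proof.
move=> gK; apply/seteqP; split=> x.
  move=> [y [yx sxy]]; have [|ngx] := pselect (range g x); last by left.
  move=> /(range_sectionP gK) gx; right; exists (s x) => //.
  move=> /card_le1P C1; apply: yx; apply: C1 => //=.
case=> [ngx|[a + <-]].
  exists (g (s x)); split; last by rewrite gK.
  by move=> gx; apply/ngx/(range_sectionP gK).
rewrite (Cset_section gK) => -[y ngy <-]; exists y; split; last by rewrite gK.
by move=> yE; apply: ngy; apply/(range_sectionP gK).
Qed.

(** If finitely many points are left over then C(s), their image under [s], is
    finite, hence so is the other part of N(s). *)
Lemma Nset_finite_section s g : cancel g s ->
  finite_set (Nset s) <-> finite_set (~` range g).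
Proof.
move=> gK; rewrite (Nset_section gK) finite_setU; split=> [[]//|Ef].
by split=> //; apply: finite_image; rewrite (Cset_section gK); exact: finite_image.
Qed.

Lemma card_Nset_section s g : cancel g s -> finite_set (Nset s) ->
  card_fset (Nset s) = card_fset (~` range g) + card_fset (Cset s).
Proof.
move=> gK Nf; have Ef := (Nset_finite_section gK).1 Nf.
have Cf : finite_set (Cset s) by rewrite (Cset_section gK); exact: finite_image.
rewrite {1}(Nset_section gK) card_fsetU_disjoint //; last first.
- by rewrite -subset0 => y [ny [a _ ay]]; apply: ny; exists a.
- exact: finite_image.
by rewrite card_fset_image //; exact: can_inj gK.
Qed.

Definition excess s : option nat :=
  if `[< finite_set (Nset s) >]
  then Some (card_fset (Nset s) - card_fset (Cset s)) else None.

(** The number of points left over is the same for all right inverses, so in a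
    composition the right inverse can be chosen as convenient. *)
Lemma excess_section s g : cancel g s -> excess s = fincard (~` range g).
Proof.
move=> gK; rewrite /excess; have [Nf|Ni] := pselect (finite_set (Nset s)).
  rewrite asboolT // (card_Nset_section gK) // addnK fincard_fin //.
  exact/(Nset_finite_section gK).
by rewrite asboolF // fincard_inf // => /(Nset_finite_section gK).
Qed.

(** [excess] is a difference of natural numbers; the truncation is harmless
    because |N(s)| is always the sum of |C(s)| and a natural number. *)
Lemma excess_eq s t : finite_set (Nset s) -> finite_set (Nset t) ->
  ((card_fset (Nset s))%:Z - (card_fset (Cset s))%:Z =
   (card_fset (Nset t))%:Z - (card_fset (Cset t))%:Z)%R <->
  excess s = excess t.
Proof.
move=> sf tf; rewrite /excess !asboolT //.
have [g gK] := surjmap_section s; have [h hK] := surjmap_section t.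
rewrite (card_Nset_section gK sf) (card_Nset_section hK tf).
rewrite !addnK !PoszD !GRing.addrK.
by split=> [[->]|[->]].
Qed.

(** A point outside the range of [h \o g] is outside the range of [h], or is
    [h y] with [y] outside the range of [g]. *)
Lemma excessM s t : excess (s * t)%g = option_add (excess s) (excess t).
Proof.
have [g gK] := surjmap_section s; have [h hK] := surjmap_section t.
have hgK : cancel (h \o g) (s * t)%g by move=> a /=; rewrite hK gK.
rewrite (excess_section gK) (excess_section hK) (excess_section hgK).
rewrite -(fincard_image (~` range g) (can_inj hK)) option_addC -fincardU; last first.
  by rewrite -subset0 => y [ny [a _ ay]]; apply: ny; exists a.
congr fincard; apply/seteqP; split=> x.
  move=> nx; have [[y _ yx]|] := pselect (range h x); last by left.
  right; exists y => // -[a _ ay]; apply: nx; exists a => //=.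
  by rewrite ay.
case=> [nx [a _ ax]|[y ny <-] [a _ /(can_inj hK) ay]].
  by apply: nx; exists (g a).
by apply: ny; exists a.
Qed.

(** * Sizes of fibres *)

Definition fibres_bounded s := exists n, forall a, fibre s a #<= `I_n.

Definition fibres_finite s := forall a, finite_set (fibre s a).

Lemma fibres_bounded_finite s : fibres_bounded s -> fibres_finite s.
Proof. by move=> [n sn] a; apply/finite_set_leP; exists n. Qed.

(** A fibre has at most one point outside N(s). *)
Lemma Nset_finite_bounded s : finite_set (Nset s) -> fibres_bounded s.
Proof.
move=> /finite_set_leP[n Nn]; have [g gK] := surjmap_section s.
exists (n + 1) => a.
have Nga : Nset s `|` [set g a] #<= `I_(n + 1).
  by apply: card_leU_add => //; rewrite (card_le_eql card_set1) card_le_II.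
apply: card_le_trans Nga; apply: subset_card_le => x xa.
have [->|xg] := pselect (x = g a); first by right.
by left; exists (g a); split; [exact/nesym|rewrite gK].
Qed.

(** [t] maps the fibre of the product onto the fibre of [s]. *)
Lemma fibre_card_leMl s t a : fibre s a #<= fibre (s * t)%g a.
Proof.
have [h hK] := surjmap_section t.
apply: card_le_trans (card_image_le t _); apply: subset_card_le => x xa.
by exists (h x) => //=; rewrite /fibre /= hK.
Qed.

Lemma fibre_card_leMr s t b : fibre t b #<= fibre (s * t)%g (s b).
Proof. by apply: subset_card_le => x; rewrite /fibre /= => ->. Qed.

Lemma fibres_boundedM s t :
  fibres_bounded (s * t)%g <-> fibres_bounded s /\ fibres_bounded t.
Proof.
split=> [[n stn]|[[n sn] [m tm]]].
  split; exists n => a; first exact: card_le_trans (fibre_card_leMl s t a) _.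
  exact: card_le_trans (fibre_card_leMr s t a) _.
exists (n * m) => a.
have /finite_setP[k sk] := fibres_bounded_finite (ex_intro _ n sn) a.
apply: (@card_le_trans _ _ _ `I_(k * m)); first exact: (card_preimage_le tm sk).
by rewrite card_le_II leq_mul2r -card_le_II -(card_le_eql sk) sn orbT.
Qed.

Lemma fibres_finiteM s t :
  fibres_finite (s * t)%g <-> fibres_finite s /\ fibres_finite t.
Proof.
split=> [stf|[sf tf] a].
  split=> a; apply: card_le_finite (stf _); first exact: fibre_card_leMl.
  exact: fibre_card_leMr.
have -> : fibre (s * t)%g a = \bigcup_(b in fibre s a) fibre t b.
  apply/seteqP; split=> [x xa|x [b ba xb]]; first by exists (t x).
  by move: ba; rewrite /fibre /= -[b]xb.
by apply: bigcup_finite => [|b _]; [exact: sf|exact: tf].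
Qed.

(** * The invariant of the classes *)

Definition fibre_type s : option nat * bool * bool :=
  (excess s, `[< fibres_bounded s >], `[< fibres_finite s >]).

Definition fibre_type_mul (u v : option nat * bool * bool) :=
  (option_add u.1.1 v.1.1, u.1.2 && v.1.2, u.2 && v.2).

Lemma fibre_type_mulC : commutative fibre_type_mul.
Proof.
by move=> u v; rewrite /fibre_type_mul option_addC andbC [u.2 && _]andbC.
Qed.

Lemma fibre_typeM s t :
  fibre_type (s * t)%g = fibre_type_mul (fibre_type s) (fibre_type t).
Proof.
rewrite /fibre_type /fibre_type_mul excessM /= -!asbool_and.
by rewrite (asbool_equiv_eq (fibres_boundedM s t))
  (asbool_equiv_eq (fibres_finiteM s t)).
Qed.

(** * The cases of the relation over a countable set *)

Section Countable.
Hypothesis Tcount : countable [set: T].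

Lemma infinite_countable_card {U : Type} (A : set U) :
  countable A -> infinite_set A -> A #= [set: nat].
Proof. by move=> Ac /infiniteP Ai; rewrite card_eq_le Ai andbT. Qed.

Lemma card_nat_infinite {U : Type} (A : set U) :
  A #= [set: nat] -> infinite_set A.
Proof. by move=> AN; apply/infiniteP; rewrite (card_le_eqr AN). Qed.

Lemma countable_subset_card (A : set T) : countable A.
Proof. exact: card_le_trans (card_leT _) Tcount. Qed.

Lemma mcard_finiteP s : finite_set (mcard s) <-> fibres_bounded s.
Proof.
have [ub lub] := mcardP s Tcount; split=> [/finite_set_leP[n mn]|[n sn]].
  by exists n => a; exact: card_le_trans (ub a) mn.
by apply/finite_set_leP; exists n; exact: lub.
Qed.

Lemma mcard_natP s : mcard s #= [set: nat] <-> ~ fibres_bounded s.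
Proof.
split=> [/card_nat_infinite mi /mcard_finiteP //|nb].
apply: infinite_countable_card => [|/mcard_finiteP //].
exact: card_leT.
Qed.

(** In a countable set, having aleph_0 elements is the same as being
    infinite. *)
Lemma achieves_mcardP s : mcard s #= [set: nat] ->
  achieves_mcard s <-> ~ fibres_finite s.
Proof.
move=> mN; split=> [[a ma] sf|].
  apply: (card_nat_infinite _ (sf a)).
  exact: card_eq_trans (card_esym ma) mN.
move=> /existsNP[a ai]; exists a; apply: card_eq_trans mN _; apply: card_esym.
by apply: infinite_countable_card => //; exact: countable_subset_card.
Qed.

Lemma Nset_natP s : Nset s #= [set: nat] <-> ~ finite_set (Nset s).
Proof.
split=> [/card_nat_infinite //|Ni]; apply: infinite_countable_card => //.
exact: countable_subset_card.
Qed.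

(** Finite N(s) implies bounded fibres, which implies finite fibres; so the
    three data distinguish four situations apart from the value of the excess,
    and these are the four cases of the relation. *)
Lemma surj_approx_fibre_type s t :
  surj_approx s t <-> fibre_type s = fibre_type t.
Proof.
have exN u : ~ finite_set (Nset u) -> excess u = None.
  by move=> nf; rewrite /excess asboolF.
have bN u : ~ fibres_bounded u -> ~ finite_set (Nset u).
  by move=> nb /Nset_finite_bounded.
split.
  rewrite /fibre_type => -[[sf tf /(excess_eq sf tf) ->]|[]|[]|[]].
  - by rewrite !asboolT //; do ?apply: fibres_bounded_finite; exact: Nset_finite_bounded.
  - move=> /Nset_natP /exN -> /Nset_natP /exN -> /mcard_finiteP sb /mcard_finiteP tb.
    by rewrite !asboolT //; exact: fibres_bounded_finite.
  - move=> /[dup] sm /mcard_natP sb /[dup] tm /mcard_natP tb.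
    move=> /(achieves_mcardP sm)/contrapT sf /(achieves_mcardP tm)/contrapT tf.
    by rewrite !exN ?bN //; try exact: bN; rewrite !(asboolF sb, asboolF tb) !asboolT.
  - move=> /[dup] sm /mcard_natP sb /[dup] tm /mcard_natP tb.
    move=> /(achieves_mcardP sm) sf /(achieves_mcardP tm) tf.
    by rewrite !exN; try exact: bN; rewrite !asboolF.
rewrite /fibre_type => -[exst eb ef].
have [bst bts] := asbool_eq_equiv eb; have [fst fts] := asbool_eq_equiv ef.
have [sf|sf] := pselect (finite_set (Nset s));
  have [tf|tf] := pselect (finite_set (Nset t)).
- by apply: Or41; split=> //; apply/excess_eq.
- by move: exst; rewrite (exN _ tf) /excess asboolT.
- by move: exst; rewrite (exN _ sf) /excess asboolT.
have [sb|sb] := pselect (fibres_bounded s).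
  by apply: Or42; split; [apply/Nset_natP|apply/Nset_natP|apply/mcard_finiteP
                         |apply/mcard_finiteP/bst].
have sm := (mcard_natP s).2 sb.
have tm : mcard t #= [set: nat] by apply/mcard_natP => /bts.
have [sff|sff] := pselect (fibres_finite s).
  apply: Or43; split=> // [/(achieves_mcardP sm)|/(achieves_mcardP tm)];
    apply=> //; exact: fst.
apply: Or44; split=> //; first exact/(achieves_mcardP sm).
by apply/(achieves_mcardP tm) => /fts.
Qed.

End Countable.
End Surjections.

Theorem theorem40 (Omega : choiceType) (hOmega : [set: Omega] #= [set: nat]) :
  congruence (@surj_approx Omega) /\
  (forall s t : surjmap Omega, perm_sim s t -> surj_approx s t).
Proof.
have cO : countable [set: Omega] by rewrite /countable (card_le_eql hOmega).
have approxP := surj_approx_fibre_type cO.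
have approx_congr : congruence (@surj_approx Omega).
  split; first split.
  - by move=> s; apply/approxP.
  - by move=> s t /approxP st; apply/approxP.
  - by move=> s t u /approxP st /approxP tu; apply/approxP; rewrite st.
  by move=> s t u /approxP st; split; apply/approxP; rewrite !fibre_typeM st.
split=> //; apply: perm_sim_sub_congruence => // s t.
by apply/approxP; rewrite !fibre_typeM fibre_type_mulC.
Qed.
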